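(* (1) Let $P=[a,b,c]$ and $Q$ be binary quadratic forms of the same discriminant such that $P$ and $Q^\vee=[a',b,c']$ are coprime and concordant. Then the lattice $\Lambda(P,Q)$, equipped with the $\mathbb{Z}$-basis $$\begin{pmatrix}a'&-b\\0&a\end{pmatrix},\qquad \begin{pmatrix}0&-\frac{c}{a'}\\1&0\end{pmatrix},$$ coincides with the quadratic form $[aa',b,\frac{c}{a'}]=P*Q^\vee$ (that is, its Gram matrix in this ordered basis is $\begin{pmatrix}2aa'&b\\ b&2c/a'\end{pmatrix}$). (2) More generally, for any coprime binary quadratic forms $P,Q$ of the same discriminant, the lattices $\Lambda(P,Q)$ and $\Lambda(P,Q)^\perp(-1)$ are isomorphic, as lattices, to $P*Q^\vee$ and $P*Q$ respectively.
   Context: A binary quadratic form $[a,b,c]$ ($a,b,c\in\mathbb{Z}$) is identified with the symmetric matrix $\begin{pmatrix}2a&b\\ b&2c\end{pmatrix}$ and with the lattice $\mathbb{Z}^2$ having this Gram matrix; its discriminant is $b^2-4ac$, and all forms are assumed non-degenerate ($b^2-4ac\ne0$), with no assumption of definiteness or primitivity. $[a,b,c]^\vee=[a,-b,c]$. $\gcd([a,b,c]):=\gcd(a,b,c)$. $\Gamma^e$ is the lattice of $2\times2$ integer matrices with the symmetric bilinear form determined by $\langle X,X\rangle=2\det X$; $\perp$ is orthogonal complement in $\Gamma^e$. For $X=\begin{pmatrix}\alpha&\beta\\ \gamma&\delta\end{pmatrix}$, $X^A=\begin{pmatrix}\delta&-\beta\\-\gamma&\alpha\end{pmatrix}$ and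 $X^t$ is the transpose. Define $\Lambda(P,Q)=\{X\in\Gamma^e\mid X^tP=QX^A\}$ with the restricted form. $L(-1)$ denotes the lattice $L$ with form negated. For forms $P=[a,b,c]$, $Q=[a',b',c']$ of the same discriminant, let $\lambda=\gcd(a,b,c,a',b',c')$. $P,Q$ are coprime if $\lambda=1$. They are concordant if $aa'\neq0$, $\gcd(a,a')=\lambda$ and $b=b'$; in that case $P*Q:=[aa',b,\frac{c}{a'}]$ (and $\frac{c}{a'}\in\mathbb{Z}$). Any pair of forms of the same discriminant can be transformed to a concordant pair by acting with $SL(2,\mathbb{Z})$ on each form separately ($P\mapsto g^tPg$); for a general coprime pair $P,Q$ of the same discriminant, $P*Q$ means $P'*Q'$ for any concordant pair $(P',Q')$ with $P'$ properly ($SL(2,\mathbb{Z})$-)equivalent to $P$ and $Q'$ properly equivalent to $Q$. *)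

(* Defs.v *)
From HB Require Import structures.
From mathcomp Require Import all_boot all_order all_algebra.

Set Implicit Arguments.
Unset Strict Implicit.
Unset Printing Implicit Defensive.

Import GRing.Theory.
Local Open Scope ring_scope.

Definition mx2 (x y z t : int) : 'M[int]_2 :=
  \matrix_(i, j) if i == 0 then (if j == 0 then x else y)
                 else (if j == 0 then z else t).

(** * Binary quadratic forms *)

(* [BQF a b c] is the form a x^2 + b x y + c y^2. *)
Record bqf := BQF { qa : int; qb : int; qc : int }.

Definition form_mx (P : bqf) : 'M[int]_2 :=
  mx2 (2 * qa P) (qb P) (qb P) (2 * qc P).

Definition disc (P : bqf) : int := qb P ^+ 2 - 4 * qa P * qc P.

Definition dual (P : bqf) : bqf := BQF (qa P) (- qb P) (qc P).

Definition content (P : bqf) : int := gcdz (qa P) (gcdz (qb P) (qc P)).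

Definition pair_gcd (P Q : bqf) : int := gcdz (content P) (content Q).

Definition coprime_forms (P Q : bqf) : Prop := pair_gcd P Q = 1.

Definition concordant (P Q : bqf) : Prop :=
  [/\ qa P * qa Q <> 0, gcdz (qa P) (qa Q) = pair_gcd P Q & qb P = qb Q].

(* Meaningful for concordant forms of the same discriminant only: the division
   is then exact. *)
Definition concordant_comp (P Q : bqf) : bqf :=
  BQF (qa P * qa Q) (qb P) (qc P %/ qa Q)%Z.

Definition properly_equivalent (P P' : bqf) : Prop :=
  exists2 g : 'M[int]_2, \det g = 1 & form_mx P' = g^T *m form_mx P *m g.

(* The product P * Q of coprime forms of the same discriminant depends on the
   choice of a concordant pair (only its proper equivalence class does not), so
   it is a relation: R is one of the possible values of P * Q. *)
Definition composition (P Q R : bqf) : Prop :=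
  exists P' Q' : bqf,
    [/\ properly_equivalent P P', properly_equivalent Q Q',
        concordant P' Q' & R = concordant_comp P' Q'].

(** * Lattices *)

(* A lattice is given by a subset L of an ambient group together with a form on
   that group, of which only the restriction to L matters. *)
Definition isometric (V W : zmodType) (L : V -> Prop) (f : V -> V -> int)
    (M : W -> Prop) (g : W -> W -> int) : Prop :=
  exists phi : V -> W,
    [/\ forall x, L x -> M (phi x),
        forall x y, L x -> L y -> phi (x + y) = phi x + phi y,
        forall x y, L x -> L y -> phi x = phi y -> x = y,
        forall z, M z -> exists2 x, L x & phi x = z
      & forall x y, L x -> L y -> g (phi x) (phi y) = f x y].

Definition is_Zbasis (V : zmodType) (L : V -> Prop) (n : nat)
    (e : n.-tuple V) : Prop :=
  (forall v, L v <-> exists x : 'I_n -> int, v = \sum_i tnth e i *~ x i) /\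
  (forall x : 'I_n -> int, \sum_i tnth e i *~ x i = 0 -> forall i, x i = 0).

Definition gram_mx (V : zmodType) (f : V -> V -> int) (n : nat)
    (e : n.-tuple V) : 'M[int]_n :=
  \matrix_(i, j) f (tnth e i) (tnth e j).

Definition full (V : zmodType) : V -> Prop := fun=> True.

Definition bqf_pairing (P : bqf) (x y : 'cV[int]_2) : int :=
  (x^T *m form_mx P *m y) 0 0.

(* The polarization of X |-> 2 det X. *)
Definition mx_pairing (X Y : 'M[int]_2) : int :=
  \det (X + Y) - \det X - \det Y.

Definition mx_pairing_neg (X Y : 'M[int]_2) : int := - mx_pairing X Y.

Definition perp (L : 'M[int]_2 -> Prop) : 'M[int]_2 -> Prop :=
  fun Y => forall X, L X -> mx_pairing X Y = 0.

(* X^A is the adjugate of X, see [adj_mx2]. *)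
Definition Lambda (P Q : bqf) : 'M[int]_2 -> Prop :=
  fun X => X^T *m form_mx P = form_mx Q *m \adj X.

Lemma mx_pairingXX (X : 'M[int]_2) : mx_pairing X X = 2 * \det X.
Proof.
rewrite /mx_pairing -mulr2n -scaler_nat detZ expr2 -natrM -addrA -opprD.
by rewrite -mulr2n -[in X in _ - X]mulr_natl -mulrBl.
Qed.

Lemma adj_mx2 (x y z t : int) : \adj (mx2 x y z t) = mx2 t (- y) (- z) x.
Proof.
apply/matrixP => i j; rewrite !mxE /cofactor det_mx11 !mxE.
by case: i j => [[|[|//]] hi] [[|[|//]] hj];
  rewrite /= ?expr0 ?expr1 ?sqrrN ?expr1n ?mul1r ?mulN1r.
Qed.

(* Main.v *)
Require Import Defs.
From HB Require Import structures.
From mathcomp Require Import all_boot all_order all_algebra ring zify.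

(** For a concordant pair, the four scalar equations defining [Lambda P Q] can be
    solved by hand: the diagonal of a solution is proportional to [(a', a)], the
    lower left entry is free, and these two parameters determine the matrix
    ([Lambda_concordant]). The coordinates so obtained give the basis and the Gram
    matrix of the first part.

    In general, proper equivalences of [P] and [Q] act on integer matrices by
    isometries that carry [Lambda P Q] along ([Lambda_equiv]), so that the
    concordant case gives [Lambda P Q] for every value of [P * dual Q]
    ([Lambda_composition]). Concordant representatives exist because a form takes,
    at some primitive vector, a value coprime to any given integer that is coprime
    to its content ([bqf_coprime_value], [composition_exists]).

    The orthogonal complement is again a lattice of the same kind. Up to a scalar,
    the equation [X^T P = Q X^A] is an eigenvector equation [T X = d X], where
    [T X] is [\adj P (\adj X)^T Q], [d = \det P], [T] is self-adjoint and
    [T^2 = d^2]. Hence the complement is the other eigenspace, which is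
    [Lambda P (- Q)] ([perp_Lambda]). By the case already settled it is isometric
    to [P * dual (- Q)], and this is [P * Q] negated, up to a change of
    orientation ([composition_dual_opp]). *)

Set Implicit Arguments.
Unset Strict Implicit.
Unset Printing Implicit Defensive.

Import GRing.Theory Num.Theory.
Local Open Scope ring_scope.

(** * Integer 2x2 matrices *)

Lemma mx2_eta (X : 'M[int]_2) : X = mx2 (X 0 0) (X 0 1) (X 1 0) (X 1 1).
Proof.
apply/matrixP => i j; rewrite !mxE.
by case: i j => [[|[|//]] hi] [[|[|//]] hj] /=; congr (X _ _); apply: val_inj.
Qed.

(** Case analysis on a matrix by [mx2P] reduces matrix identities to polynomial
    identities between entries. *)
Variant mx2_spec : 'M[int]_2 -> Type := Mx2Spec x y z t : mx2_spec (mx2 x y z t).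

Lemma mx2P (X : 'M[int]_2) : mx2_spec X.
Proof. by rewrite [X]mx2_eta. Qed.

Lemma mx2_inj x y z t x' y' z' t' :
  mx2 x y z t = mx2 x' y' z' t' -> [/\ x = x', y = y', z = z' & t = t'].
Proof.
by move=> /matrixP e; move: (e 0 0) (e 0 1) (e 1 0) (e 1 1); rewrite !mxE.
Qed.

Lemma mulmx2 x y z t x' y' z' t' :
  mx2 x y z t *m mx2 x' y' z' t' =
  mx2 (x * x' + y * z') (x * y' + y * t') (z * x' + t * z') (z * y' + t * t').
Proof. by rewrite [LHS]mx2_eta !mxE !big_ord_recr !big_ord0 /= !mxE !add0r. Qed.

Lemma trmx2 x y z t : (mx2 x y z t)^T = mx2 x z y t.
Proof. by rewrite [LHS]mx2_eta !mxE. Qed.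

Lemma addmx2 x y z t x' y' z' t' :
  mx2 x y z t + mx2 x' y' z' t' = mx2 (x + x') (y + y') (z + z') (t + t').
Proof. by rewrite [LHS]mx2_eta !mxE. Qed.

Lemma mulrzmx2 x y z t k : mx2 x y z t *~ k = mx2 (x * k) (y * k) (z * k) (t * k).
Proof.
rewrite -scaler_int [LHS]mx2_eta !mxE /=.
by congr mx2; rewrite mulrC intz.
Qed.

Lemma scalemx2 x y z t k : k *: mx2 x y z t = mx2 (k * x) (k * y) (k * z) (k * t).
Proof. by rewrite [LHS]mx2_eta !mxE. Qed.

Lemma detmx2 x y z t : \det (mx2 x y z t) = x * t - y * z.
Proof.
have:= congr1 (fun M : 'M[int]_2 => M 0 0) (mul_mx_adj (mx2 x y z t)).
by rewrite /= adj_mx2 mulmx2 !mxE /= mulr1n => <-; ring.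
Qed.

Lemma det_adj2 (X : 'M[int]_2) : \det (\adj X) = \det X.
Proof. by case/mx2P: X => x y z t; rewrite adj_mx2 !detmx2; ring. Qed.

Lemma adj_mulmx2 (X Y : 'M[int]_2) : \adj (X *m Y) = \adj Y *m \adj X.
Proof.
case/mx2P: X => x y z t; case/mx2P: Y => x' y' z' t'.
by rewrite mulmx2 !adj_mx2 mulmx2; congr mx2; ring.
Qed.

Lemma adj2K (X : 'M[int]_2) : \adj (\adj X) = X.
Proof. by case/mx2P: X => x y z t; rewrite !adj_mx2 !opprK. Qed.

Lemma mx_pairing2 x y z t x' y' z' t' :
  mx_pairing (mx2 x y z t) (mx2 x' y' z' t') = x * t' + x' * t - y * z' - y' * z.
Proof. by rewrite /mx_pairing addmx2 !detmx2; ring. Qed.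

Lemma bqf_pairingE R (u v : 'cV[int]_2) :
  bqf_pairing R u v = 2 * qa R * u 0 0 * v 0 0
   + qb R * (u 0 0 * v 1 0 + u 1 0 * v 0 0)
   + 2 * qc R * u 1 0 * v 1 0.
Proof.
rewrite /bqf_pairing !mxE !big_ord_recr !big_ord0 /= !mxE.
rewrite !big_ord_recr !big_ord0 /= !mxE /= !add0r.
rewrite (_ : widen_ord _ _ = 0); last exact: val_inj.
by rewrite (_ : ord_max = 1); [ring | exact: val_inj].
Qed.

(** * Proper equivalence, content and discriminant *)

Definition bqf_eval P (x y : int) := qa P * x ^+ 2 + qb P * x * y + qc P * y ^+ 2.

Lemma properly_equivalentP P P' : properly_equivalent P P' <->
  exists x y z t, [/\ x * t - z * y = 1, qa P' = bqf_eval P x y,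
    qb P' = 2 * qa P * x * z + qb P * (x * t + z * y) + 2 * qc P * y * t
   & qc P' = bqf_eval P z t].
Proof.
split.
  case=> g; case/mx2P: g => x z y t; rewrite detmx2 /form_mx trmx2 !mulmx2.
  move=> dg /mx2_inj[e1 e2 _ e3]; exists x, y, z, t; rewrite /bqf_eval.
  by split=> //; lia.
case=> x [y [z [t [dg e1 e2 e3]]]]; exists (mx2 x z y t); first by rewrite detmx2.
by rewrite /form_mx trmx2 !mulmx2 e1 e2 e3 /bqf_eval; congr mx2; ring.
Qed.

Lemma properly_equivalent_sym P P' :
  properly_equivalent P P' -> properly_equivalent P' P.
Proof.
case=> g dg e; exists (\adj g); first by rewrite det_adj2.
have h : g *m \adj g = 1%:M by rewrite mul_mx_adj dg.
by rewrite e -!mulmxA h mulmx1 mulmxA -trmx_mul h trmx1 mul1mx.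
Qed.

Lemma content_dvd P d : (d %| content P)%Z = [&& d %| qa P, d %| qb P & d %| qc P]%Z.
Proof. by rewrite /content !dvdz_gcd. Qed.

Lemma dvd_content_equiv P P' :
  properly_equivalent P P' -> (content P %| content P')%Z.
Proof.
case/properly_equivalentP=> x [y [z [t [_ e1 e2 e3]]]].
have := dvdzz (content P); rewrite {1}content_dvd => /and3P[ha hb hc].
rewrite content_dvd e1 e2 e3 /bqf_eval.
by apply/and3P; split; rewrite ?rpredD //; do ?[exact: dvdz_mull | apply: dvdz_mulr].
Qed.

Lemma coprime_forms_equiv P Q P' Q' :
  properly_equivalent P P' -> properly_equivalent Q Q' ->
  coprime_forms P Q -> coprime_forms P' Q'.
Proof.
move=> /properly_equivalent_sym/dvd_content_equiv hP.
move=> /properly_equivalent_sym/dvd_content_equiv hQ.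
rewrite /coprime_forms /pair_gcd => e.
have : (gcdz (content P') (content Q') %| gcdz (content P) (content Q))%Z.
  by rewrite dvdz_gcd (dvdz_trans _ hP) ?dvdz_gcdl // (dvdz_trans _ hQ) ?dvdz_gcdr.
by rewrite e dvdz1 => /eqP; rewrite /gcdz /= => ->.
Qed.

Lemma det_form_mx P : \det (form_mx P) = - disc P.
Proof. by rewrite detmx2 /disc; ring. Qed.

Lemma disc_equiv P P' : properly_equivalent P P' -> disc P' = disc P.
Proof.
case=> g dg /(congr1 determinant); rewrite !det_mulmx det_tr dg mulr1 mul1r.
by rewrite !det_form_mx => /oppr_inj.
Qed.

Definition opp_bqf (P : bqf) : bqf := BQF (- qa P) (- qb P) (- qc P).

Lemma form_mx_opp P : form_mx (opp_bqf P) = - form_mx P.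
Proof. by rewrite -scaleN1r /form_mx scalemx2; congr mx2; rewrite /=; ring. Qed.

Lemma disc_opp P : disc (opp_bqf P) = disc P.
Proof. by rewrite /disc /=; ring. Qed.

Lemma disc_dual P : disc (dual P) = disc P.
Proof. by rewrite /disc /=; ring. Qed.

Lemma dualK : involutive dual.
Proof. by case=> a b c; rewrite /dual /= opprK. Qed.

Lemma content_dual P : content (dual P) = content P.
Proof. by rewrite /content /= gcdNz. Qed.

Lemma content_opp P : content (opp_bqf P) = content P.
Proof. by rewrite /content /= !(gcdNz, gcdzN). Qed.

Lemma properly_equivalent_opp P P' :
  properly_equivalent P P' -> properly_equivalent (opp_bqf P) (opp_bqf P').
Proof. by case=> g dg e; exists g; rewrite // !form_mx_opp e mulmxN mulNmx. Qed.

Lemma properly_equivalent_dual P P' :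
  properly_equivalent P P' -> properly_equivalent (dual P) (dual P').
Proof.
case/properly_equivalentP=> x [y [z [t [dg ea eb ec]]]].
apply/properly_equivalentP; exists x, (- y), (- z), t.
by rewrite /bqf_eval /= ea eb ec /bqf_eval; split; [rewrite -dg | | |]; ring.
Qed.

(** * Existence of the product *)

Lemma coprime_primeP (m n : nat) : (0 < n)%N ->
  (forall p, prime p -> p %| m -> p %| n -> False)%N -> coprime m n.
Proof.
move=> n0 h; rewrite /coprime; apply/idPn => g1.
have g0 : (0 < gcdn m n)%N by rewrite gcdn_gt0 n0 orbT.
have pp : prime (pdiv (gcdn m n)) by apply: pdiv_prime; lia.
have := pdiv_dvd (gcdn m n); rewrite dvdn_gcd => /andP[].
exact: h.
Qed.

Lemma Euclid_dvdzM (p : nat) (m n : int) : prime p ->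
  (p %| m * n)%Z = (p %| m)%Z || (p %| n)%Z.
Proof. by move=> pp; rewrite !dvdzE abszM Euclid_dvdM. Qed.

Lemma prime_dvd_part (pi : nat_pred) (p N : nat) :
  prime p -> (0 < N)%N -> (p %| N)%N ->
  (p %| N`_pi)%N = (p \in pi).
Proof.
move=> pp N0 pN; have := mem_primes p N`_pi; rewrite pp part_gt0 /= => <-.
by rewrite primes_part mem_filter mem_primes pp N0 pN /= andbT.
Qed.

(** For each prime [p] dividing [N], one of the monomials [a x^2], [c y^2],
    [b x y] can be made the only one that is nonzero modulo [p]: the first when
    [p] does not divide [a], with [p] dividing [y] only; the second when [p]
    divides [a] but not [c], with [p] dividing [x] only; the third otherwise,
    with [p] dividing neither, since then [p] cannot divide [b] too. Taking for
    [x] and [y] the parts of [N] supported on the relevant primes does this for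
    all [p] at once, and [x] and [y] are coprime because those sets of primes are
    disjoint. *)
Lemma bqf_coprime_value P (N : nat) : (0 < N)%N -> coprimez (content P) N ->
  exists x y : int, coprimez x y /\ coprimez (bqf_eval P x y) N.
Proof.
move=> N0 cop.
pose A : nat_pred := [pred p : nat | ~~ (p %| qa P)%Z].
pose B : nat_pred := [pred p : nat | (p %| qa P)%Z && ~~ (p %| qc P)%Z].
exists (N`_B)%N, (N`_A)%N; split.
  rewrite coprimez_sym; apply: (@pnat_coprime A); first exact: part_pnat.
  apply: (sub_in_pnat _ (part_pnat B N)) => p _.
  by rewrite !inE => /andP[->].
apply: coprime_primeP => // p pp pv pN.
have dvX (m : int) : (p %| m ^+ 2)%Z = (p %| m)%Z.
  by rewrite expr2 Euclid_dvdzM // orbb.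
have xE : (p %| Posz (N`_B)%N)%Z = (p \in B) by rewrite dvdzE prime_dvd_part.
have yE : (p %| Posz (N`_A)%N)%Z = (p \in A) by rewrite dvdzE prime_dvd_part.
have {}pv : (p %| bqf_eval P (N`_B)%N (N`_A)%N)%Z by rewrite dvdzE.
have {cop} : ~~ (p %| content P)%Z.
  apply: contraTN cop; rewrite dvdzE coprimezE => pc.
  apply: contraTN pp => /eqP cop.
  by have := dvdn_gcd p `|content P|%N N; rewrite cop pN pc dvdn1 => /eqP->.
rewrite content_dvd => cop; move: pv xE yE; rewrite !inE /bqf_eval.
case pa: (p %| qa P)%Z cop => /=; last first.
  move=> _ pv xE yE; move: pv.
  rewrite rpredDr; last by rewrite dvdz_mull // dvX.
  rewrite rpredDr; last exact: dvdz_mull.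
  by rewrite Euclid_dvdzM // dvX xE pa.
case pc: (p %| qc P)%Z => /=.
  rewrite andbT => pb pv xE yE; move: pv.
  rewrite rpredDr; last exact: dvdz_mulr.
  rewrite rpredDl; last exact: dvdz_mulr.
  by rewrite !Euclid_dvdzM // xE yE (negPf pb).
move=> _ pv xE yE; move: pv.
rewrite rpredDl; last first.
  by rewrite rpredD //; [exact: dvdz_mulr | apply/dvdz_mulr/dvdz_mull].
by rewrite Euclid_dvdzM // dvX yE pc.
Qed.

(** When [n] is a unit, zero is coprime to it. To exclude the value zero, [n] is
    enlarged to [n (m^2 + 1)], with [m] the content: this is still coprime to [m],
    and it is not a unit. *)
Lemma bqf_nonzero_coprime_value P (n : int) : content P != 0 -> n != 0 ->
  coprimez (content P) n ->
  exists x y : int,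
    [/\ coprimez x y, coprimez (bqf_eval P x y) n & bqf_eval P x y != 0].
Proof.
set m := content P => m0 n0 cop.
have cop' : coprimez m (n * (m ^+ 2 + 1)).
  rewrite coprimezMr cop; apply/coprimezP; exists (- m, 1) => /=; ring.
case: (@bqf_coprime_value P `|n * (m ^+ 2 + 1)|).
- by have := sqr_ge0 m; nia.
- by rewrite coprimezE absz_id -coprimezE.
move=> x [y [cxy]]; rewrite coprimezE absz_id -coprimezE => cF.
exists x, y; split=> //; first by move: cF; rewrite coprimezMr => /andP[].
apply: contraTneq cF => ->; rewrite coprimezE absz0 /coprime gcd0n; apply/negP.
have := sqr_ge0 m; nia.
Qed.

(** A primitive vector is the first column of a matrix of determinant one. *)
Lemma properly_represents P x y : coprimez x y ->
  exists2 P', properly_equivalent P P' & qa P' = bqf_eval P x y.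
Proof.
case/coprimezP => -[u v] /= e.
exists (BQF (bqf_eval P x y)
  (2 * qa P * x * - v + qb P * (x * u + - v * y) + 2 * qc P * y * u)
  (bqf_eval P (- v) u)) => //.
apply/properly_equivalentP; exists x, y, (- v), u; split=> //.
by rewrite -e; ring.
Qed.

Lemma content_neq0 P : disc P <> 0 -> content P != 0.
Proof.
move=> d0; apply: contra_notN d0 => /eqP c0.
have := content_dvd P 0; rewrite c0 dvdz0 !dvd0z.
case/esym/and3P=> [/eqP a0 /eqP b0 /eqP c0'].
by rewrite /disc a0 b0 c0'.
Qed.

Lemma properly_equivalent_trans P Q R :
  properly_equivalent P Q -> properly_equivalent Q R -> properly_equivalent P R.
Proof.
case=> g dg eg [h dh eh]; exists (g *m h); first by rewrite det_mulmx dg dh.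
by rewrite eh eg trmx_mul !mulmxA.
Qed.

Lemma properly_equivalent_shift P k :
  properly_equivalent P (BQF (qa P) (qb P + 2 * qa P * k) (bqf_eval P k 1)).
Proof.
apply/properly_equivalentP; exists 1, 0, k, 1.
by rewrite /bqf_eval /=; split; ring.
Qed.

(** Replace [P], then [Q], so that the leading coefficients [a], [a'] are coprime
    and nonzero: [a] is chosen coprime to the content of [Q], which allows [a'] to
    be chosen coprime to [a]. The middle coefficients have the parity of the
    common discriminant, and shifts change them by multiples of [2 a] and [2 a'];
    a Bezout relation between [a] and [a'] makes them equal. *)
Lemma composition_exists P Q : disc P <> 0 -> disc P = disc Q ->
  coprime_forms P Q -> exists R, composition P Q R.
Proof.
move=> dP eD cop.
have mP := content_neq0 dP.
have mQ : content Q != 0 by apply: content_neq0; rewrite -eD.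
have cPQ : coprimez (content P) (content Q) by apply/eqP.
have [x [y [/properly_represents rep]]] := bqf_nonzero_coprime_value mP mQ cPQ.
have [P1 eqvP <- {rep}] := rep P; rewrite coprimez_sym => ca a0.
have [x' [y' [/properly_represents rep]]] := bqf_nonzero_coprime_value mQ a0 ca.
have [Q1 eqvQ <- {rep}] := rep Q; rewrite coprimez_sym => caa a'0.
have [w ew] : exists w, qb Q1 - qb P1 = 2 * w.
  have := disc_equiv eqvP; have := disc_equiv eqvQ; rewrite -eD => <-.
  rewrite /disc => e.
  (* Equal discriminants give equal squares modulo 4. *)
  suff /dvdzP[w] : (2 %| qb Q1 - qb P1)%Z by exists w; lia.
  nia.
have [[u v] /= euv] := coprimezP _ _ caa.
pose P2 := BQF (qa P1) (qb P1 + 2 * qa P1 * (w * u)) (bqf_eval P1 (w * u) 1).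
pose Q2 := BQF (qa Q1) (qb Q1 + 2 * qa Q1 * - (w * v)) (bqf_eval Q1 (- (w * v)) 1).
have eP2 : properly_equivalent P P2.
  exact: properly_equivalent_trans (properly_equivalent_shift _ _).
have eQ2 : properly_equivalent Q Q2.
  exact: properly_equivalent_trans (properly_equivalent_shift _ _).
exists (concordant_comp P2 Q2), P2, Q2; split=> //; split.
- by apply/eqP; rewrite mulf_neq0.
- by rewrite (coprime_forms_equiv eP2 eQ2 cop); apply/eqP.
rewrite /=; apply/eqP; rewrite -subr_eq0; apply/eqP.
rewrite (_ : _ - _ = 2 * w * (u * qa P1 + v * qa Q1) - (qb Q1 - qb P1)).
  by rewrite euv ew; ring.
ring.
Qed.

(** * The lattice of a concordant pair *)

Lemma LambdaE P Q x y z t : Lambda P Q (mx2 x y z t) <->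
  [/\ 2 * qa P * x + qb P * z = 2 * qa Q * t - qb Q * z,
      qb P * x + 2 * qc P * z = qb Q * x - 2 * qa Q * y,
      2 * qa P * y + qb P * t = qb Q * t - 2 * qc Q * z
    & qb P * y + 2 * qc P * t = 2 * qc Q * x - qb Q * y].
Proof.
rewrite /Lambda /form_mx adj_mx2 trmx2 !mulmx2; split.
  by case/mx2_inj => *; split; lia.
by case=> *; congr mx2; lia.
Qed.

(** Equal discriminants mean [a c = a' c'], so that [a'] divides [c] by Gauss's
    lemma; this exactness is what makes the division in the product legitimate. *)
Lemma concordant_tail a b c a' c' :
  disc (BQF a b c) = disc (BQF a' b c') -> coprimez a a' -> a' <> 0 ->
  exists2 q, c = a' * q & c' = a * q.
Proof.
rewrite /disc /= => e cop a'0.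
have {}e : a * c = a' * c' by lia.
have : (a' %| a * c)%Z by rewrite e dvdz_mulr.
rewrite Gauss_dvdzr; last by rewrite coprimez_sym.
case/dvdzP=> q ec; exists q; first by rewrite ec mulrC.
by apply: (mulfI (introN eqP a'0)); rewrite -e ec; ring.
Qed.

(** The diagonal [(x, t)] satisfies [a x = a' t] with [a], [a'] coprime, hence is
    [k (a', a)]; the second equation then gives the upper right entry, and the
    other two follow. The parameters [k], [g] are the coordinates of [X] in the
    basis of the theorem. *)
Lemma Lambda_concordant a b a' q X : a' <> 0 -> coprimez a a' ->
  Lambda (BQF a b (a' * q)) (BQF a' (- b) (a * q)) X <->
    exists k g, X = mx2 (a' * k) (- b * k - q * g) g (a * k).
Proof.
move=> a'0 cop; split; last first.
  by case=> k [g ->]; apply/LambdaE; rewrite /=; split; ring.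
case/mx2P: X => x y z t /LambdaE[/= e1 e2 _ _].
have {}e1 : a * x = a' * t by lia.
have : (a' %| a * x)%Z by rewrite e1 dvdz_mulr.
rewrite Gauss_dvdzr; last by rewrite coprimez_sym.
case/dvdzP=> k ex; exists k, z; rewrite ex mulrC.
have inj := mulfI (introN eqP a'0).
by congr mx2; apply: inj; [lia | rewrite -e1 ex; ring].
Qed.

Lemma Lambda_concordant_isometric a b a' q : a' <> 0 -> coprimez a a' ->
  isometric (Lambda (BQF a b (a' * q)) (BQF a' (- b) (a * q))) mx_pairing
            (@full 'cV[int]_2) (bqf_pairing (BQF (a * a') b q)).
Proof.
move=> a'0 cop; have LE X := @Lambda_concordant a b a' q X a'0 cop.
pose phi (X : 'M[int]_2) : 'cV[int]_2 :=
  \col_(i < 2) (if i == 0 then divz (X 0 0) a' else X 1 0).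
have phiE k g : phi (mx2 (a' * k) (- b * k - q * g) g (a * k)) =
    \col_(i < 2) (if i == 0 then k else g).
  by apply/colP => i; rewrite !mxE /= mulKz //; apply/eqP.
have phi0 k g : phi (mx2 (a' * k) (- b * k - q * g) g (a * k)) 0 0 = k.
  by rewrite phiE mxE.
have phi1 k g : phi (mx2 (a' * k) (- b * k - q * g) g (a * k)) 1 0 = g.
  by rewrite phiE mxE.
exists phi; split=> //.
- move=> _ _ /LE[k [g ->]] /LE[k' [g' ->]].
  rewrite addmx2 (_ : mx2 _ _ _ _ = mx2 (a' * (k + k'))
     (- b * (k + k') - q * (g + g')) (g + g') (a * (k + k'))); last by congr mx2; ring.
  by rewrite !phiE; apply/colP=> i; rewrite !mxE; case: ifP.
- move=> _ _ /LE[k [g ->]] /LE[k' [g' ->]].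
  by rewrite !phiE => /colP e; move: (e 0) (e 1); rewrite !mxE /= => -> ->.
- move=> v _; exists (mx2 (a' * v 0 0) (- b * v 0 0 - q * v 1 0) (v 1 0) (a * v 0 0)).
    by apply/LE; exists (v 0 0), (v 1 0).
  rewrite phiE; apply/colP=> -[[|[|//]] hi]; rewrite !mxE /=; congr (v _ _); exact: val_inj.
move=> _ _ /LE[k [g ->]] /LE[k' [g' ->]].
by rewrite bqf_pairingE !phi0 !phi1 mx_pairing2 /=; ring.
Qed.

Lemma Lambda_concordant_basis a b a' q : a' <> 0 -> coprimez a a' ->
  is_Zbasis (Lambda (BQF a b (a' * q)) (BQF a' (- b) (a * q)))
            [tuple mx2 a' (- b) 0 a; mx2 0 (- q) 1 0].
Proof.
move=> a'0 cop; have LE X := @Lambda_concordant a b a' q X a'0 cop.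
have sumE (x : 'I_2 -> int) :
    \sum_i tnth [tuple mx2 a' (- b) 0 a; mx2 0 (- q) 1 0] i *~ x i =
    mx2 (a' * x 0) (- b * x 0 - q * x 1) (x 1) (a * x 0).
  rewrite !big_ord_recr big_ord0 /= add0r !(tnth_nth 0) /= !mulrzmx2 addmx2.
  rewrite (_ : widen_ord _ _ = 0); last exact: val_inj.
  rewrite (_ : ord_max = 1); last exact: val_inj.
  by congr mx2; ring.
split=> [v | x].
  rewrite LE; split=> [[k [g ->]] | [x ->]].
    by exists (fun i => if i == 0 then k else g); rewrite sumE.
  by exists (x 0), (x 1); rewrite sumE.
rewrite sumE (_ : 0 = mx2 0 0 0 0); last by rewrite [LHS]mx2_eta !mxE.
case/mx2_inj=> /eqP + _ x1 _; rewrite mulf_eq0 (introF eqP a'0) /= => /eqP x0.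
by case=> [[|[|//]] hi]; [rewrite -x0 | rewrite -x1]; congr (x _); apply: val_inj.
Qed.

Lemma Lambda_concordant_gram (a b a' q : int) :
  gram_mx mx_pairing [tuple mx2 a' (- b) 0 a; mx2 0 (- q) 1 0] =
  form_mx (BQF (a * a') b q).
Proof.
rewrite [LHS]mx2_eta /form_mx !mxE !(tnth_nth 0) /= !mx_pairing2.
by congr mx2; ring.
Qed.

(** * Isometries *)

Lemma isometric_trans (U V W : zmodType) (L : U -> Prop) (M : V -> Prop)
    (N : W -> Prop) f g h :
  isometric L f M g -> isometric M g N h -> isometric L f N h.
Proof.
case=> p [p1 p2 p3 p4 p5] [r [r1 r2 r3 r4 r5]]; exists (r \o p); split=> /=.
- by move=> x /p1/r1.
- by move=> x y Lx Ly; rewrite p2 // r2 //; apply: p1.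
- by move=> x y Lx Ly /r3 e; apply: p3 => //; apply: e; apply: p1.
- by move=> z /r4[y /p4[x Lx <-] <-]; exists x.
by move=> x y Lx Ly; rewrite r5 ?p5 //; apply: p1.
Qed.

Lemma isometric_opp (V W : zmodType) (L : V -> Prop) (M : W -> Prop) f g :
  isometric L f M g ->
  isometric L (fun x y => - f x y) M (fun x y => - g x y).
Proof.
case=> p [p1 p2 p3 p4 p5]; exists p; split=> // x y Lx Ly; congr (- _).
exact: p5.
Qed.

Lemma isometric_eql (V W : zmodType) (L L' : V -> Prop) (M : W -> Prop) f g :
  (forall x, L' x <-> L x) -> isometric L f M g -> isometric L' f M g.
Proof.
move=> e [p [p1 p2 p3 p4 p5]]; exists p; split.
- by move=> x /e/p1.
- by move=> x y /e Lx /e; apply: p2.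
- by move=> x y /e Lx /e; apply: p3.
- by move=> z /p4[x /e Lx <-]; exists x.
by move=> x y /e Lx /e; apply: p5.
Qed.

(** If [P' = g^T P g] and [Q' = h^T Q h], then [X |-> g^-1 X h] turns the equation
    [X^T P = Q X^A] into the one for [P'] and [Q']. *)
Lemma Lambda_equiv_sub P Q P' Q' (g h X : 'M[int]_2) :
  \det g = 1 -> \det h = 1 ->
  form_mx P' = g^T *m form_mx P *m g -> form_mx Q' = h^T *m form_mx Q *m h ->
  Lambda P Q X -> Lambda P' Q' (\adj g *m X *m h).
Proof.
rewrite /Lambda => dg dh -> -> e.
rewrite !adj_mulmx2 adj2K !trmx_mul.
have hK : h *m \adj h = 1%:M by rewrite mul_mx_adj dh.
have gK : (\adj g)^T *m g^T = 1%:M by rewrite -trmx_mul mul_mx_adj dg trmx1.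
rewrite !mulmxA -[in LHS](mulmxA _ _ g^T) gK mulmx1.
rewrite -[in RHS](mulmxA _ h) hK mulmx1.
by rewrite -(mulmxA h^T X^T) e !mulmxA.
Qed.

Lemma mx_pairing_equiv (g h X Y : 'M[int]_2) : \det g = 1 -> \det h = 1 ->
  mx_pairing (\adj g *m X *m h) (\adj g *m Y *m h) = mx_pairing X Y.
Proof.
move=> dg dh.
by rewrite /mx_pairing -mulmxDl -mulmxDr !det_mulmx det_adj2 dg dh !mul1r !mulr1.
Qed.

Lemma Lambda_equiv P Q P' Q' :
  properly_equivalent P P' -> properly_equivalent Q Q' ->
  isometric (Lambda P Q) mx_pairing (Lambda P' Q') mx_pairing.
Proof.
move=> [g dg eg] [h dh eh]; exists (fun X => \adj g *m X *m h).
have gK : g *m \adj g = 1%:M by rewrite mul_mx_adj dg.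
have gK' : \adj g *m g = 1%:M by rewrite mul_adj_mx dg.
have hK : h *m \adj h = 1%:M by rewrite mul_mx_adj dh.
have hK' : \adj h *m h = 1%:M by rewrite mul_adj_mx dh.
split.
- by move=> X; apply: Lambda_equiv_sub.
- by move=> X Y _ _; rewrite mulmxDr mulmxDl.
- move=> X Y _ _ /(congr1 (fun Z => g *m Z *m \adj h)).
  by rewrite /= !mulmxA gK !mul1mx -!mulmxA hK !mulmx1.
- move=> Z LZ; exists (g *m Z *m \adj h); last first.
    by rewrite !mulmxA gK' mul1mx -mulmxA hK' mulmx1.
  rewrite -[g]adj2K; apply: Lambda_equiv_sub LZ; rewrite ?det_adj2 //.
    by rewrite eg !mulmxA -trmx_mul gK trmx1 mul1mx -mulmxA gK mulmx1.
  by rewrite eh !mulmxA -trmx_mul hK trmx1 mul1mx -mulmxA hK mulmx1.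
by move=> X Y _ _; apply: mx_pairing_equiv.
Qed.

(** The dual of a form properly equivalent to [dual Q] is properly equivalent to
    [Q], so a concordant pair for [P * dual Q] is reached by an equivalence that
    carries [Lambda P Q] to the lattice of a concordant pair. *)
Lemma Lambda_composition P Q R :
  disc P = disc Q -> coprime_forms P (dual Q) -> composition P (dual Q) R ->
  isometric (Lambda P Q) mx_pairing (@full 'cV[int]_2) (bqf_pairing R).
Proof.
move=> eD cop [P' [Q' [eP eQ [aa0 gaa eb] ->]]].
have eQ2 : properly_equivalent Q (dual Q').
  by rewrite -[Q]dualK; apply: properly_equivalent_dual.
apply: isometric_trans (Lambda_equiv eP eQ2) _.
have eD' : disc P' = disc Q'.
  by rewrite (disc_equiv eP) eD (disc_equiv eQ) disc_dual.
have := coprime_forms_equiv eP eQ cop; rewrite /coprime_forms -gaa => cop'.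
case: P' Q' {eP eQ eQ2 gaa} eb aa0 eD' cop' => [a b c] [a' b' c'] /= <- aa0 eD' cop'.
have a'0 : a' <> 0 by move=> e; apply: aa0; rewrite e mulr0.
have {}cop' : coprimez a a' by apply/eqP.
have [q ec ec'] := concordant_tail eD' cop' a'0.
rewrite /concordant_comp /dual /= ec ec' mulKz; last exact/eqP.
exact: Lambda_concordant_isometric.
Qed.

(** * The orthogonal complement *)

(** The equation [X^T P = Q X^A], transposed, multiplied by [\adj P] on the left
    and read as an equation for [X], says that [X] is an eigenvector of this operator. *)
Definition twist P Q X := \adj (form_mx P) *m (\adj X)^T *m form_mx Q.

Lemma mx_pairingDl X Y Z : mx_pairing (X + Y) Z = mx_pairing X Z + mx_pairing Y Z.
Proof.
case/mx2P: X => ? ? ? ?; case/mx2P: Y => ? ? ? ?; case/mx2P: Z => ? ? ? ?.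
by rewrite addmx2 !mx_pairing2; ring.
Qed.

Lemma mx_pairingZl k X Y : mx_pairing (k *: X) Y = k * mx_pairing X Y.
Proof.
case/mx2P: X => ? ? ? ?; case/mx2P: Y => ? ? ? ?.
by rewrite scalemx2 !mx_pairing2; ring.
Qed.

Lemma mx_pairingC X Y : mx_pairing X Y = mx_pairing Y X.
Proof.
case/mx2P: X => ? ? ? ?; case/mx2P: Y => ? ? ? ?.
by rewrite !mx_pairing2; ring.
Qed.

Lemma mx_pairing_nondegenerate Y : (forall X, mx_pairing X Y = 0) -> Y = 0.
Proof.
case/mx2P: Y => x y z t h.
move: (h (mx2 1 0 0 0)) (h (mx2 0 1 0 0)) (h (mx2 0 0 1 0)) (h (mx2 0 0 0 1)).
rewrite !mx_pairing2 => e1 e2 e3 e4.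
by rewrite [RHS]mx2_eta !mxE; congr mx2; lia.
Qed.

Lemma twistD P Q X Y : twist P Q (X + Y) = twist P Q X + twist P Q Y.
Proof.
rewrite /twist -mulmxDl -mulmxDr; congr (_ *m _ *m _).
case/mx2P: X => ? ? ? ?; case/mx2P: Y => ? ? ? ?.
by rewrite addmx2 !adj_mx2 !trmx2 addmx2; congr mx2; ring.
Qed.

Lemma twistZ P Q k X : twist P Q (k *: X) = k *: twist P Q X.
Proof.
rewrite /twist scalemxAl scalemxAr; congr (_ *m _ *m _).
case/mx2P: X => ? ? ? ?.
by rewrite scalemx2 !adj_mx2 !trmx2 scalemx2; congr mx2; ring.
Qed.

Lemma twist_opp P Q X : twist P (opp_bqf Q) X = - twist P Q X.
Proof. by rewrite /twist form_mx_opp mulmxN. Qed.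

Lemma trmx_form P : (form_mx P)^T = form_mx P.
Proof. by rewrite /form_mx trmx2. Qed.

(** For equal discriminants, [twist P Q] is thus an involution up to the factor
    [disc P]. *)
Lemma twistK P Q X : twist P Q (twist P Q X) = (disc P * disc Q) *: X.
Proof.
rewrite /twist !adj_mulmx2 [(\adj X)^T]trmx_adj !adj2K !trmx_mul trmxK.
rewrite [(\adj (form_mx Q))^T]trmx_adj !trmx_form.
rewrite !mulmxA mul_adj_mx -!mulmxA mul_adj_mx !det_form_mx.
by rewrite mul_scalar_mx mul_mx_scalar scalerA mulrNN.
Qed.

Lemma twist_selfadjoint P Q X Y :
  mx_pairing (twist P Q X) Y = mx_pairing X (twist P Q Y).
Proof.
case/mx2P: X => ? ? ? ?; case/mx2P: Y => ? ? ? ?.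
by rewrite /twist /form_mx !adj_mx2 !trmx2 !mulmx2 !mx_pairing2; ring.
Qed.

Lemma Lambda_twist P Q X : disc P <> 0 ->
  Lambda P Q X <-> twist P Q X = - disc P *: X.
Proof.
move=> dP; have tE : Lambda P Q X <-> form_mx P *m X = (\adj X)^T *m form_mx Q.
  by split=> /(congr1 trmx); rewrite !trmx_mul ?trmxK !trmx_form.
rewrite tE /twist -mulmxA -det_form_mx; split=> [<- | e].
  by rewrite mulmxA mul_adj_mx mul_scalar_mx.
have d0 : \det (form_mx P) != 0 by rewrite det_form_mx oppr_eq0; apply/eqP.
apply: (scalemx_inj d0).
by rewrite scalemxAr -e !mulmxA mul_mx_adj -mulmxA mul_scalar_mx.
Qed.

(** [Lambda P Q] and [Lambda P (- Q)] are the eigenspaces of the self-adjoint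
    [twist P Q] for the opposite nonzero eigenvalues [- disc P] and [disc P], hence
    are orthogonal. Conversely [- disc P *: Z + twist P Q Z] lies in [Lambda P Q]
    for every [Z]; if [Y] is orthogonal to all of these, self-adjointness moves
    the operator onto [Y], and nondegeneracy of the form puts [Y] in the second
    eigenspace. *)
Lemma perp_Lambda P Q Y : disc P <> 0 -> disc P = disc Q ->
  perp (Lambda P Q) Y <-> Lambda P (opp_bqf Q) Y.
Proof.
move=> dP eD; rewrite Lambda_twist // twist_opp scaleNr; split.
  move=> pY; apply/eqP; rewrite eqr_oppLR opprK -subr_eq0; apply/eqP.
  apply: mx_pairing_nondegenerate => Z.
  rewrite -scaleNr mx_pairingC mx_pairingDl mx_pairingZl -!(mx_pairingC Z).
  rewrite -twist_selfadjoint -mx_pairingZl -mx_pairingDl.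
  apply: pY; apply/Lambda_twist => //.
  by rewrite twistD twistZ twistK -eD scalerDr scalerA mulrNN addrC.
move=> /oppr_inj eY X /(Lambda_twist _ _ dP) eX.
have := twist_selfadjoint P Q X Y.
rewrite eX eY [RHS]mx_pairingC !mx_pairingZl [mx_pairing Y X]mx_pairingC => e.
have : disc P * mx_pairing X Y = 0 by lia.
by move/eqP: dP => dP /eqP; rewrite mulf_eq0 (negPf dP) => /eqP.
Qed.

(** If [[a, b, c]] and [[a', b, c']] are concordant, so are [[a, b, c]] and
    [[- a', b, - c']], whose product is [[- a a', b, - c / a']]: up to sign and
    change of orientation, the same product. *)
Lemma composition_dual_opp P Q R : composition P Q R ->
  exists2 R', composition P (dual (opp_bqf Q)) R' & R = dual (opp_bqf R').
Proof.
move=> [P' [Q' [eP eQ [aa0 gaa eb] ->]]].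
exists (concordant_comp P' (dual (opp_bqf Q'))).
  exists P', (dual (opp_bqf Q')); split=> //.
    exact/properly_equivalent_dual/properly_equivalent_opp.
  split; rewrite /= ?opprK //; first by rewrite mulrN => /eqP; rewrite oppr_eq0 => /eqP.
  by rewrite gcdzN gaa /pair_gcd content_dual content_opp.
by rewrite /concordant_comp /dual /opp_bqf /= mulrN divzN !opprK.
Qed.

(** A form and its dual are improperly equivalent, by [diag(1, -1)]. *)
Lemma isometric_dual R : isometric (@full 'cV[int]_2) (bqf_pairing R)
  (@full 'cV[int]_2) (bqf_pairing (dual R)).
Proof.
pose J : 'M[int]_2 := mx2 1 0 0 (- 1).
have JK : J *m J = 1%:M.
  by rewrite mulmx2 [RHS]mx2_eta !mxE; congr mx2; ring.
have JJ (u : 'cV[int]_2) : J *m (J *m u) = u by rewrite mulmxA JK mul1mx.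
exists (mulmx J); split=> //.
- by move=> x y _ _; rewrite mulmxDr.
- by move=> x y _ _ e; rewrite -[x]JJ e JJ.
- by move=> z _; exists (J *m z).
move=> x y _ _; rewrite /bqf_pairing trmx_mul !mulmxA -2!(mulmxA x^T).
congr ((_ *m _ *m _) 0 0).
by rewrite trmx2 /form_mx !mulmx2; congr mx2; rewrite /=; ring.
Qed.

Lemma bqf_pairing_opp R x y : bqf_pairing (opp_bqf R) x y = - bqf_pairing R x y.
Proof. by rewrite /bqf_pairing form_mx_opp mulmxN mulNmx mxE. Qed.

Lemma perp_Lambda_composition P Q R : disc P <> 0 ->
  disc P = disc Q -> coprime_forms P Q -> composition P Q R ->
  isometric (perp (Lambda P Q)) mx_pairing_neg (@full 'cV[int]_2) (bqf_pairing R).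
Proof.
move=> dP eD cop /composition_dual_opp[R' compR' ->].
apply: (isometric_eql (fun Y => perp_Lambda Y dP eD)).
apply: isometric_trans (isometric_dual _).
have /isometric_opp : isometric (Lambda P (opp_bqf Q)) mx_pairing
    (@full 'cV[int]_2) (bqf_pairing R').
  apply: Lambda_composition compR'; first by rewrite disc_opp.
  by rewrite /coprime_forms /pair_gcd content_dual content_opp.
case=> phi [p1 p2 p3 p4 p5]; exists phi; split=> // x y Lx Ly.
by rewrite bqf_pairing_opp p5.
Qed.

Theorem theorem5p13 :
  (forall (a b c a' c' : int) (P Q : bqf),
     P = BQF a b c ->
     dual Q = BQF a' b c' ->
     disc P <> 0 -> disc Q <> 0 ->
     disc P = disc Q ->
     coprime_forms P (dual Q) ->
     concordant P (dual Q) ->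
     let e := [tuple mx2 a' (- b) 0 a; mx2 0 (- (c %/ a')%Z) 1 0] in
     [/\ is_Zbasis (Lambda P Q) e,
         gram_mx mx_pairing e = form_mx (BQF (a * a') b (c %/ a')%Z)
       & BQF (a * a') b (c %/ a')%Z = concordant_comp P (dual Q)])
  /\
  (forall P Q : bqf,
     disc P <> 0 -> disc Q <> 0 ->
     disc P = disc Q ->
     coprime_forms P Q ->
     [/\ exists R, composition P (dual Q) R,
         forall R, composition P (dual Q) R ->
           isometric (Lambda P Q) mx_pairing
                     (@full 'cV[int]_2) (bqf_pairing R),
         exists R, composition P Q R
       & forall R, composition P Q R ->
           isometric (perp (Lambda P Q)) mx_pairing_neg
                     (@full 'cV[int]_2) (bqf_pairing R)]).
Proof.
split.
  move=> a b c a' c' P Q eP eQ _ _; rewrite -(disc_dual Q) -[Q in Lambda _ Q]dualK eQ eP.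
  rewrite /coprime_forms => eD cop [/= /eqP + gaa _]; rewrite cop in gaa.
  rewrite mulf_eq0 => /norP[_ /eqP a'0].
  have caa : coprimez a a' by apply/eqP.
  have [q ec ec'] := concordant_tail eD caa a'0.
  rewrite /dual /= ec ec' mulKz; last exact/eqP.
  split; [exact: Lambda_concordant_basis | exact: Lambda_concordant_gram | ].
  by rewrite /concordant_comp /= mulKz //; apply/eqP.
move=> P Q dP _ eD cop.
have copd : coprime_forms P (dual Q).
  by rewrite /coprime_forms /pair_gcd content_dual.
split.
- by apply: composition_exists; rewrite ?disc_dual.
- by move=> R; apply: Lambda_composition.
- exact: composition_exists.
by move=> R; apply: perp_Lambda_composition.
Qed.
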